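(* Let $\alpha$ be a positive integer, $p$ a prime, and $(G,+,0)$ a finite abelian $p$-group of order $p^{\alpha}$. Suppose that there is a complete splitting $G=MS$, with $M$ a set of integers and $S\subseteq G$. Then $|M|=1$ if $r(G)\ge 2$; and $|M|=1$ or $|S|=1$ if $r(G)=1$.
   Context: For a set of integers $M$ and a subset $S$ of a finite abelian group $G$ (written additively), $G=MS$ is a complete splitting if every element of $G$ (including $0$) has a unique representation $ms$ with $m\in M$, $s\in S$. If $G\cong\mathbb{Z}_{n_1}\oplus\cdots\oplus\mathbb{Z}_{n_k}$ with $1<n_1\mid n_2\mid\cdots\mid n_k$, then $r(G)=k$ is the rank of $G$. *)

(* Defs.v *)
From HB Require Import structures.
From mathcomp Require Import all_boot all_order all_algebra all_fingroup.
From mathcomp Require Import all_solvable.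
From mathcomp Require Import classical_sets cardinality.

Set Implicit Arguments.
Unset Strict Implicit.
Unset Printing Implicit Defensive.

Import GRing.Theory.
Local Open Scope ring_scope.

(* M is not assumed finite: finiteness follows from uniqueness. *)
Definition complete_splitting (G : finZmodType) (M : set int) (S : {set G}) :
    Prop :=
  forall g : G, exists! ms : int * G,
    [/\ M ms.1, ms.2 \in S & g = ms.2 *~ ms.1].

Section RankDirectSum.
Local Open Scope group_scope.

Lemma p_rank_bigdprod (gT : finGroupType) (p : nat) (I : Type) (r : seq I)
    (A : I -> {group gT}) (B : {group gT}) :
  \big[dprod/1]_(i <- r) A i = B ->
  'r_p(B) = (\sum_(i <- r) 'r_p(A i))%N.
Proof.
elim: r B => [|i r IHr] B; first by rewrite !big_nil => <-; rewrite p_rank1.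
rewrite !big_cons => defB; have [[_ K _ defK] _ _ _] := dprodP defB.
by rewrite defK in defB; rewrite -(p_rank_dprod _ defB) (IHr _ defK).
Qed.

(* The library defines 'r(G) as the largest rank of an elementary abelian
   subgroup; for an abelian group this is its number of invariant factors. *)
Lemma rank_direct_sum (G : finZmodType) (k : nat) (n : k.-tuple nat) :
  all (fun m => 1 < m)%N n -> sorted dvdn n ->
  [set: G] \isog [set: {dffun forall i : 'I_k, 'Z_(tnth n i)}] ->
  'r([set: G]) = k.
Proof.
move=> n_gt1 n_dvd isoG; rewrite (isog_rank isoG) {G isoG}.
have gt1 i : (1 < tnth n i)%N by apply: (allP n_gt1); apply: mem_tnth.
pose H (i : 'I_k) := [set: 'Z_(tnth n i)]%G.
have defT : \big[dprod/1]_(i < k) set1gXn (H i)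
    = [set: {dffun forall i : 'I_k, 'Z_(tnth n i)}].
  rewrite setXn_dprod; apply/setP=> x; rewrite finset.in_setT; apply/setXnP=> i.
  by rewrite finset.in_setT.
have rkE p : 'r_p([set: {dffun forall i : 'I_k, 'Z_(tnth n i)}])
    = (\sum_i 'r_p(H i))%N.
  rewrite (p_rank_bigdprod p defT); apply: eq_bigr => i _.
  exact/esym/isog_p_rank/(isog_setXn (H i)).
have cycH i : cyclic (H i).
  by apply/cyclicP; exists (Zp1 : 'Z_(tnth n i)); rewrite -Zp_cycle.
have cardH i : #|H i| = tnth n i by rewrite cardsT card_ord Zp_cast.
apply/eqP; rewrite eqn_leq; apply/andP; split.
  have [p _ ->] :=
    rank_witness [set: {dffun forall i : 'I_k, 'Z_(tnth n i)}]%G.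
  rewrite rkE -[leqRHS]card_ord -sum1_card; apply: leq_sum => i _.
  apply: leq_trans (p_rank_le_rank p _) _.
  by rewrite -abelian_rank1_cyclic ?cyclic_abelian.
case: k => // k in n n_gt1 n_dvd gt1 H defT rkE cycH cardH *.
have p_pr := pdiv_prime (gt1 ord0); set p := pdiv _ in p_pr.
apply: leq_trans (p_rank_le_rank p _); rewrite rkE.
rewrite -[leqLHS]card_ord -sum1_card; apply: leq_sum => i _.
rewrite p_rank_gt0 mem_primes p_pr cardG_gt0 [X in (_ %| X)%N](cardH i).
apply: dvdn_trans (pdiv_dvd _) _; rewrite !(tnth_nth 0%N).
by apply: (sorted_leq_nth dvdn_trans dvdnn) => //; rewrite inE size_tuple.
Qed.

End RankDirectSum.

(* Main.v *)
Require Import Defs.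
From HB Require Import structures.
From mathcomp Require Import all_boot all_order all_algebra all_fingroup.
From mathcomp Require Import all_solvable.
From mathcomp Require Import classical_sets cardinality.

Set Implicit Arguments.
Unset Strict Implicit.
Unset Printing Implicit Defensive.

Import GRing.Theory.
Local Open Scope ring_scope.
Local Open Scope card_scope.

(* If [0] is in [M] then [S] is a singleton. Otherwise let [v] be the p-adic
   valuation on [M] and let [p ^ w s] be the order of [s] in [S]; then [m s] has
   order [p ^ (w s - v m)] (truncated), so exactly one pair (m0, s0), the one
   representing 0, satisfies [w s <= v m]. If [p] divided both |M| and |S|, the
   least value of [v] and the greatest value of [w] taken a number of times
   prime to [p] would differ by some k >= 2, and the number of elements of order
   [p ^ k] would be prime to [p]; but it is a difference of orders of two
   nontrivial p-groups. As |M| |S| is a power of [p], |M| = 1 or |S| = 1, and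
   in the latter case [G] is cyclic. *)

(** Otherwise [T] minus [t0], which is a fiber by itself, would be a union of fibers of size
    divisible by [p], giving |T| = 1 mod [p]. *)
Lemma ndvd_fiber_exists (T : finType) (f : T -> nat) (p : nat) (t0 : T) :
  prime p -> (p %| #|T|)%N -> (forall t, f t = f t0 -> t = t0) ->
  exists2 t, f t != f t0 & ~~ (p %| #|[pred u | f u == f t]|)%N.
Proof.
move=> p_pr p_dvd t0_uniq.
have [/existsP[t /andP[]]|/existsPn all_dvd] :=
    boolP [exists t, (f t != f t0) && ~~ (p %| #|[pred u | f u == f t]|)%N].
  by exists t.
move: p_dvd; rewrite (cardD1 t0) inE dvdn_addl.
  by rewrite /= dvdn1 => /eqP p1; rewrite p1 in p_pr.
pose N := (\max_t f t).+1.
have ltN t : (f t < N)%N by rewrite ltnS leq_bigmax.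
rewrite -sum1_card (partition_big (fun t => Ordinal (ltN t)) xpredT) //=.
apply: dvdn_sum => i _.
have [t /andP[t_neq /eqP ft]|none] :=
    pickP [pred t | (t != t0) && (f t == i)].
  have ft_neq : f t != f t0 by apply: contraNneq t_neq => /t0_uniq ->.
  have := all_dvd t; rewrite ft_neq negbK -sum1_card; apply: etrans.
  congr (_ %| _)%N; apply: eq_bigl => u; rewrite !inE -val_eqE /= ft.
  by case: eqP => [->|]; rewrite /= ?andbT // -ft eq_sym (negPf ft_neq).
rewrite big_pred0 // => u; rewrite !inE andbT -val_eqE /=.
  exact: none u.
Qed.

(* Take [x1] of least [v] and [y1] of greatest [w] among the points with fiber
   size prime to [p]. Modulo [p], the number of pairs with
   [w y - v x = w y1 - v x1] is the product of these two fiber sizes. *)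
Lemma difference_fibers_contra (X Y : finType) (v : X -> nat) (w : Y -> nat)
    (p : nat) (x0 : X) (y0 : Y) :
  prime p -> (p %| #|X|)%N -> (p %| #|Y|)%N ->
  (w y0 <= v x0)%N ->
  (forall x y, (w y <= v x)%N -> x = x0 /\ y = y0) ->
  ~ (forall k, (2 <= k)%N ->
       (p %| #|[pred xy : X * Y | w xy.2 - v xy.1 == k]|)%N).
Proof.
move=> p_pr pX pY le0 uniq0 p_dvd.
have [x2 x2neq x2nd] :
    exists2 x, v x != v x0 & ~~ (p %| #|[pred u | v u == v x]|)%N.
  apply: ndvd_fiber_exists => // x vx.
  by have [] := uniq0 x y0; rewrite ?vx.
have [y2 y2neq y2nd] :
    exists2 y, w y != w y0 & ~~ (p %| #|[pred u | w u == w y]|)%N.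
  apply: ndvd_fiber_exists => // y wy.
  by have [] := uniq0 x0 y; rewrite ?wy.
have [x1 x1nd x1min] := @arg_minnP _ x2
  (fun x => ~~ (p %| #|[pred u | v u == v x]|)%N) v x2nd.
have [y1 y1nd y1max] := @arg_maxnP _ y2
  (fun y => ~~ (p %| #|[pred u | w u == w y]|)%N) w y2nd.
have lt_v x : v x != v x0 -> (v x < w y0)%N.
  by move=> neq; rewrite ltnNge; apply: contraNN neq => /uniq0[->].
have lt_w y : w y != w y0 -> (v x0 < w y)%N.
  by move=> neq; rewrite ltnNge; apply: contraNN neq => /uniq0[_ ->].
have x1lt : (v x1 < w y0)%N.
  by apply: leq_ltn_trans (x1min _ x2nd) (lt_v _ x2neq).
have y1lt : (v x0 < w y1)%N.
  by apply: leq_trans (lt_w _ y2neq) (y1max _ y2nd).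
(* The chain [v x1 < w y0 <= v x0 < w y1] has two strict steps. *)
have lt11 : (v x1 + 2 <= w y1)%N.
  by rewrite addn2; apply: leq_trans y1lt; rewrite ltnS; apply: leq_trans le0.
pose k := (w y1 - v x1)%N.
have k_gt1 : (2 <= k)%N by rewrite leq_subRL // (leq_trans _ lt11) // leq_addr.
have k_gt0 : (0 < k)%N by apply: leq_trans k_gt1.
pose a i := #|[pred u | v u == i]|; pose b j := #|[pred u | w u == j]|.
pose N := (\max_x v x).+1.
have ltN x : (v x < N)%N by rewrite ltnS leq_bigmax.
have := p_dvd k k_gt1.
have -> : #|[pred xy : X * Y | (w xy.2 - v xy.1)%N == k]| =
    (\sum_(i < N) a i * b (i + k))%N.
  (* As [k] is positive, truncation does not interfere: the difference is [k] exactly when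
     [w y = v x + k]. *)
  rewrite -sum1_card (eq_bigl (fun xy : X * Y =>
      xpredT xy.1 && (w xy.2 == (v xy.1 + k)%N))); last first.
    move=> [x y] /=; rewrite !inE /=.
    apply/eqP/eqP => [wv|->]; last by rewrite addKn.
    by rewrite -wv subnKC // ltnW // -subn_gt0 wv.
  rewrite -(pair_big_dep xpredT (fun x y => w y == (v x + k)%N)
    (fun _ _ => 1%N)) /=.
  rewrite (partition_big (fun x => Ordinal (ltN x)) xpredT) //=.
  apply: eq_bigr => i _; rewrite -sum_nat_const; apply: eq_big => [x|x /eqP <-].
    by rewrite inE -val_eqE.
  by rewrite sum1_card.
(* Only the term at [v x1] survives modulo [p]: below it [p] divides [a i] by minimality, and above
   it [i + k] exceeds [w y1], so [p] divides [b (i + k)] by maximality. Empty fibers have size 0. *)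
rewrite (bigD1 (Ordinal (ltN x1))) //= dvdn_addl; last first.
  apply: dvdn_sum => i; rewrite -val_eqE /= => i_neq.
  have [lt_i|gt_i|/eqP] := ltngtP i (v x1); last by rewrite (negPf i_neq).
    apply: dvdn_mulr; rewrite /a; apply: contraLR lt_i => nd; rewrite -leqNgt.
    have [x /eqP vx|none] := pickP [pred u | v u == i].
      by rewrite -vx; apply: x1min; rewrite vx.
    by rewrite eq_card0 // dvdn0 in nd.
  apply: dvdn_mull; rewrite /b; apply: contraLR gt_i => nd; rewrite -leqNgt.
  have [y /eqP wy|none] := pickP [pred u | w u == (i + k)%N].
    rewrite -(leq_add2r k) -wy subnKC; first by apply: y1max; rewrite wy.
    by apply: leq_trans lt11; rewrite leq_addr.
  by rewrite eq_card0 // dvdn0 in nd.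
rewrite Euclid_dvdM // (negPf x1nd) subnKC ?(negPf y1nd) //.
by apply: leq_trans lt11; rewrite leq_addr.
Qed.

Lemma dvd_card_order_pexp (gT : finGroupType) (G : {group gT}) (p k : nat) :
  prime p -> abelian G -> p.-group%g G -> (2 <= k)%N ->
  (p %| #|[set x in G | #[x]%g == (p ^ k)%N]|)%N.
Proof.
move=> p_pr abG pG k_gt1.
have [G1|ntG] := eqVneq (G : {set gT}) 1%g.
  rewrite eq_card0 ?dvdn0 // => x; rewrite !inE G1 inE.
  case: eqP => // ->; rewrite order1 -(expn0 p) eqn_exp2l ?prime_gt1 //.
  by case: k k_gt1.
have [_ p_dvd _] := pgroup_pdiv pG ntG.
have LdivE n : 'Ldiv_(p ^ n)(G)%g = 'Ohm_n(G)%g.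
  by rewrite (OhmEabelian pG) // (abelianS (Ohm_sub _ _)).
have -> : [set x in G | #[x]%g == (p ^ k)%N] = ('Ohm_k(G) :\: 'Ohm_k.-1(G))%g.
  apply/setP => x; rewrite -!LdivE !inE -!order_dvdn.
  case: (x \in G); rewrite ?andbF //=.
  case: k k_gt1 => //= k k_gt1.
  apply/eqP/andP => [->|[nd]].
    by rewrite dvdnn dvdn_Pexp2l ?prime_gt1 // ltnn.
  case/(dvdn_pfactor _ _ p_pr) => m; rewrite leq_eqVlt => /orP[/eqP->//|].
  by move=> m_le ox; rewrite ox dvdn_Pexp2l ?prime_gt1 // -ltnS m_le in nd.
rewrite cardsD (finset.setIidPr (Ohm_leq _ (leq_pred k))).
(* An element of order [p] lies in each of these subgroups. The bound [2 <= k] makes this apply to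
   [k.-1] as well. *)
have dvdOhm n : (0 < n)%N -> (p %| #|'Ohm_n(G)%g|)%N.
  move=> n_gt0; have [x xG ox] := Cauchy p_pr p_dvd.
  have xO : x \in 'Ohm_n(G)%g.
    by rewrite -LdivE !inE xG -order_dvdn ox -{1}(expn1 p) dvdn_exp2l.
  by rewrite -ox orderE cardSg // cycle_subG.
by rewrite dvdn_sub ?dvdOhm //; case: k k_gt1 => [|[]].
Qed.

(** The order of a multiple is [#[s]] divided by its gcd with |m|, and a - min(a, b) is truncated
    subtraction. At [m = 0] the formula breaks, since [logn p 0] is 0. *)
Lemma logn_order_mulrz (G : finZmodType) (p : nat) (s : G) (m : int) :
  m != 0 ->
  logn p #[s *~ m]%g = (logn p #[s]%g - logn p `|m|%N)%N.
Proof.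
move=> m_neq0.
have -> : #[s *~ m]%g = #[(s ^+ `|m|%N)%g]%g.
  case: m {m_neq0} => n //.
  by rewrite NegzE mulrNz -FinRing.zmodVgE orderV.
rewrite orderXgcd logn_div ?dvdn_gcdl // logn_gcd ?order_gt0 ?absz_gt0 //.
by rewrite minnE subKn ?leq_subr.
Qed.

Lemma pgroup_splitting_trivial (G : finZmodType) (p alpha : nat) (M : set int)
    (S : {set G}) :
  prime p -> #|G| = (p ^ alpha)%N -> complete_splitting M S ->
  M #= (`I_1)%classic \/ #|S| = 1%N.
Proof.
move=> p_pr cardG splitMS.
have /fin_all_exists[h hP] : forall g : G, exists ms, unique
    (fun ms : int * G => [/\ M ms.1, ms.2 \in S & g = ms.2 *~ ms.1]) ms.
  exact: splitMS.
have hM g : M (h g).1 by have [[]] := hP g.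
have hS g : (h g).2 \in S by have [[]] := hP g.
have hE g : (h g).2 *~ (h g).1 = g by have [[]] := hP g.
have hU m s : M m -> s \in S -> h (s *~ m) = (m, s).
  by move=> Mm Ss; have [_] := hP (s *~ m); apply.
have [M0|M0] := boolp.EM (M 0).
  right; apply/eqP/cards1P; exists (h 0).2; apply/setP => s; rewrite inE.
  apply/idP/eqP => [Ss|->//].
  by have := hU 0 s M0 Ss; rewrite mulr0z => ->.
(* This is [M] as a finite type: any [m] in [M] is the first component of [h (s *~ m)], for any [s]
   in [S]. *)
pose X : finType := seq_sub (codom (fun g => (h g).1)).
pose Y : finType := {s : G | s \in S}.
have XM (x : X) : M (val x) by have /codomP[g ->] := valP x.
pose f (xy : X * Y) := val xy.2 *~ val xy.1.
pose f' (g : G) : X * Y :=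
  (SeqSub (codom_f (fun g => (h g).1) g), exist _ (h g).2 (hS g)).
have fK : cancel f f'.
  move=> [x y]; have e := hU _ _ (XM x) (valP y).
  by congr (_, _); apply: val_inj; rewrite /= e.
have f'K : cancel f' f by move=> g; rewrite /f /= hE.
have f_bij : bijective f by exists f'.
have cardXY : (#|X| * #|Y|)%N = (p ^ alpha)%N.
  by rewrite -card_prod -cardG; apply: bij_eq_card f_bij.
have card1 n : (n %| p ^ alpha)%N -> ~~ (p %| n)%N -> n = 1%N.
  by case/(dvdn_pfactor _ _ p_pr) => -[|i] _ -> //; rewrite expnS dvdn_mulr.
have [pX|ndX] := boolP (p %| #|X|)%N; last first.
  left; suff -> : M = [set (h 0).1]%classic by exact: card_set1.
  have /card_le1_eqP X1 : (#|X| <= 1)%N.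
    by rewrite (card1 _ _ ndX) // -cardXY dvdn_mulr.
  rewrite eqEsubset; split=> [m Mm|_ -> //].
  have e := hU m (h 0).2 Mm (hS 0).
  have := X1 (f' ((h 0).2 *~ m)).1 (f' 0).1 isT isT.
  by move/(congr1 val); rewrite /= e.
have [pY|ndY] := boolP (p %| #|Y|)%N; last first.
  right; rewrite -(card1 _ _ ndY) -?cardXY ?dvdn_mull //.
  by rewrite card_sig; apply: eq_card => s; rewrite inE.
have pG : p.-group%g [set: G]%G by rewrite /pgroup cardsT cardG pnatX pnat_id.
have logf xy : logn p #[f xy]%g =
    (logn p #[val xy.2]%g - logn p `|val xy.1|%N)%N.
  rewrite logn_order_mulrz //; apply/eqP => x0.
  by apply: M0; rewrite -x0.
have orderE (g : G) : #[g]%g = (p ^ logn p #[g]%g)%N.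
  by rewrite -p_part part_pnat_id //; apply: (mem_p_elt pG); rewrite finset.in_setT.
(* The base point is the pair representing 0: by [logf], [w y <= v x] says that the product has
   order 1. *)
case: (@difference_fibers_contra X Y (fun x => logn p `|val x|%N)
  (fun y => logn p #[val y]%g) p (f' 0).1 (f' 0).2) => //.
- by rewrite -subn_eq0 -(logf (f' 0)) f'K order1 logn1.
- move=> x y; rewrite -subn_eq0 -(logf (x, y)) => /eqP log0.
  have /eqP : #[f (x, y)]%g = 1%N by rewrite orderE log0.
  by rewrite order_eq1 => /eqP f0; rewrite -[0 : G]f0 fK.
move=> k k_gt1.
have := dvd_card_order_pexp p_pr (FinRing.zmod_abelian [set: G]) pG k_gt1.
rewrite -(on_card_preimset (onW_bij _ f_bij)); apply: etrans.
congr (_ %| _)%N; apply: eq_card => xy; rewrite !inE -logf.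
by rewrite [in RHS]orderE eqn_exp2l ?prime_gt1.
Qed.

Theorem proposition6 (alpha p : nat) (alpha_gt0 : (0 < alpha)%N)
    (p_prime : prime p) (G : finZmodType) (cardG : #|G| = (p ^ alpha)%N)
    (M : set int) (S : {set G}) (splitMS : complete_splitting M S) :
  ((2 <= 'r([set: G])%g)%N -> M #= (`I_1)%classic) /\
  ('r([set: G])%g = 1%N -> M #= (`I_1)%classic \/ #|S| = 1%N).
Proof.
have triv := pgroup_splitting_trivial p_prime cardG splitMS.
split=> // rG; case: triv => // /eqP/cards1P[s S1].
(* With [S] reduced to [s], all of [G] consists of multiples of [s], which contradicts rank at least
   2. *)
suff cycG : cyclic [set: G].
  by rewrite (abelian_rank1_cyclic (FinRing.zmod_abelian _)) leqNgt rG in cycG.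
apply/cyclicP; exists s; apply/esym/eqP; rewrite -finset.subTset.
apply/fintype.subsetP => g _; have [[m t] [[_]]] := splitMS g.
rewrite S1 inE => /eqP -> -> _ /=; case: m => n.
  exact: mem_cycle.
by rewrite NegzE mulrNz -FinRing.zmodVgE groupV; apply: mem_cycle.
Qed.
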